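(* Let $f:\mathbb{F}_2^n\to\mathbb{C}$ satisfy $|f(x)|\le1$ for all $x$, and let $\xi>0$. There is a randomized sampling procedure that makes $n\log n\,\mathrm{poly}(1/\xi)$ queries to $f$ and, with probability at least $1-1/n^2$, samples from a probability distribution $\mu_f$ on $\mathbb{F}_2^{2n}$ that satisfies $$\big|\mu_f(F)-(\tilde P_f*\tilde P_f)(F)\big|\le\frac{\xi|F|}{2^n}\quad\text{for all }F\subseteq\mathbb{F}_2^{2n}.$$
   Context: $\widehat g(b)=\mathbb{E}_{x\in\mathbb{F}_2^n}g(x)(-1)^{b\cdot x}$ with $b\cdot x=\sum_ib_ix_i$; $\Delta_af(x)=f(x+a)\overline{f(x)}$. $\tilde P_f(a,b)=2^{-n}|\widehat{\Delta_af}(b)|^2$ for $(a,b)\in\mathbb{F}_2^n\times\mathbb{F}_2^n$, and $(\tilde P_f*\tilde P_f)(z)=\sum_{w\in\mathbb{F}_2^{2n}}\tilde P_f(w)\tilde P_f(z+w)$; for nonzero $f$ this measure equals $\|f\|_2^8Q_f$, where $Q_f=P_f*P_f$ and $P_f=\tilde P_f/\|f\|_2^4$ is a probability distribution. Measures are extended to sets by summation.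
   Formalization: The sampling claim assumes the necessary condition 1 − (P̃_f*P̃_f)(F_2^{2n}) ≤ ξ2^n, automatic for ξ ≥ 2^{-n}; without it no such probability distribution μ_f exists, e.g. for f = 0 and ξ < 2^{-n}. Also n ≥ 1. *)

(* Defs.v *)
From HB Require Import structures.
From mathcomp Require Import all_boot all_order all_algebra.
From mathcomp Require Import reals exp.
From mathcomp Require Import complex.

Set Implicit Arguments.
Unset Strict Implicit.
Unset Printing Implicit Defensive.

Import Order.TTheory GRing.Theory Num.Theory.
Local Open Scope ring_scope.

(** * Finite probability distributions *)

Record fdist (R : realType) (I : finType) := FDist {
  pmf :> I -> R;
  pmf_ge0 : forall i, 0 <= pmf i;
  pmf_sum1 : \sum_i pmf i = 1
}.

Definition meas (R : realType) (T : finType) (m : T -> R) (F : {set T}) : R :=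
  \sum_(z in F) m z.

(** * Randomized query procedures

A procedure is a decision tree whose internal nodes either query an unknown
function [X -> A] or draw one of [0, ..., N-1] from a distribution that may
depend on everything seen so far.  The tree itself does not depend on the
unknown function, which it can only access through its [Query] nodes. *)

Inductive sampler (R : realType) (X A O : Type) : Type :=
| Output of O
| Query of X & (A -> sampler R X A O)
| Draw (N : nat) of fdist R 'I_N & ('I_N -> sampler R X A O).

(* Worst case over the internal randomness. *)
Fixpoint nqueries (R : realType) (X A O : Type) (t : sampler R X A O)
    (f : X -> A) : nat :=
  match t with
  | Output _ => 0
  | Query x k => (nqueries (k (f x)) f).+1
  | Draw _ _ k => \max_i nqueries (k i) f
  end.

(* Probability, over the internal randomness of [t] run on [f], that [E s o]
   holds, where [s] is the sequence of all values drawn, in chronological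
   order, and [o] is the output.  For fixed [f], [s] determines the run. *)
Fixpoint Pr_run (R : realType) (X A O : Type) (t : sampler R X A O)
    (f : X -> A) (E : seq nat -> O -> bool) : R :=
  match t with
  | Output o => (E [::] o)%:R
  | Query x k => Pr_run (k (f x)) f E
  | Draw _ p k => \sum_i p i * Pr_run (k i) f (fun s o => E (val i :: s) o)
  end.

(* There is an event, on the internal randomness of [t] run on [f], of
   probability at least [q], conditionally on which the output has law [mu]. *)
Definition samples_with_prob (R : realType) (X A : Type) (O : finType)
    (t : sampler R X A O) (f : X -> A) (q : R) (mu : fdist R O) : Prop :=
  exists E : seq nat -> bool,
    q <= Pr_run t f (fun s _ => E s) /\
    forall z : O, Pr_run t f (fun s o => E s && (o == z)) =
                  Pr_run t f (fun s _ => E s) * mu z.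

(** * Fourier analysis on F_2^n *)

Notation F2 n := 'rV['F_2]_n.

Definition dotp (n : nat) (b x : F2 n) : 'F_2 := \sum_(i < n) b 0 i * x 0 i.

Definition fourier (R : realType) (n : nat) (g : F2 n -> R[i]) (b : F2 n) :
    R[i] :=
  (2 ^+ n)^-1 * \sum_(x : F2 n) g x * (-1) ^+ (dotp b x : nat).

Definition mderiv (R : realType) (n : nat) (a : F2 n) (f : F2 n -> R[i])
    (x : F2 n) : R[i] :=
  f (x + a) * (f x)^*%C.

Definition Ptilde (R : realType) (n : nat) (f : F2 n -> R[i])
    (w : F2 n * F2 n) : R :=
  (2 ^+ n)^-1 * ComplexField.Normc.normc (fourier (mderiv w.1 f) w.2) ^+ 2.

Definition convol (R : realType) (n : nat) (P Q : F2 n * F2 n -> R)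
    (z : F2 n * F2 n) : R :=
  \sum_(w : F2 n * F2 n) P w * Q (z + w).

Definition PPtilde (R : realType) (n : nat) (f : F2 n -> R[i]) :
    F2 n * F2 n -> R :=
  convol (Ptilde f) (Ptilde f).

(** * Existence of the approximating distribution

A probability distribution [mu] with
[|mu F - PPtilde f F| <= xi * #|F| / 2 ^ n] for all [F] does not exist for all
[f] and [xi]: the total mass of [PPtilde f] is [||f||_2 ^ 8], which may be much
smaller than [1], and for [f = 0] the instance [F = setT] requires
[1 <= xi * 2 ^ n].  The following condition, which is that instance, is
necessary; it holds whenever [2 ^ - n <= xi]. *)

Definition mass_condition (R : realType) (n : nat) (f : F2 n -> R[i])
    (xi : R) : Prop :=
  1 - meas (PPtilde f) setT <= xi * #|[set: F2 n * F2 n]|%:R / 2 ^+ n.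

Lemma PPtilde_ge0 (R : realType) (n : nat) (f : F2 n -> R[i]) z :
  0 <= PPtilde f z.
Proof.
apply: sumr_ge0 => w _.
by apply: mulr_ge0; apply: mulr_ge0; rewrite ?invr_ge0 ?exprn_ge0 //;
  case: (fourier _ _) => a b; apply: sqrtr_ge0.
Qed.

Lemma mass_condition_necessary (R : realType) (n : nat) (f : F2 n -> R[i])
    (xi : R) (mu : fdist R (F2 n * F2 n)%type) :
  (forall F : {set F2 n * F2 n},
     `|meas mu F - meas (PPtilde f) F| <= xi * #|F|%:R / 2 ^+ n) ->
  mass_condition f xi.
Proof.
move=> /(_ setT); rewrite /mass_condition.
have -> : meas mu [set: F2 n * F2 n] = 1.
  by rewrite /meas -(pmf_sum1 mu); apply: eq_bigl => z; rewrite inE.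
exact/le_trans/ler_norm.
Qed.

Lemma mass_condition_large_xi (R : realType) (n : nat) (f : F2 n -> R[i])
    (xi : R) :
  (2 ^+ n)^-1 <= xi -> mass_condition f xi.
Proof.
move=> xi_ge; rewrite /mass_condition.
have m_ge0 : 0 <= meas (PPtilde f) setT.
  by apply: sumr_ge0 => z _; apply: PPtilde_ge0.
apply: (@le_trans _ _ 1); first by rewrite gerBl.
have n2 : 0 < 2 ^+ n :> R by rewrite exprn_gt0.
rewrite cardsT card_prod card_mx mul1n card_Fp // natrM natrX -mulrA mulfK ?lt0r_neq0 //.
by rewrite -ler_pdivrMr // div1r.
Qed.

(* Main.v *)
(* Write [chi_b x = (-1) ^ (b . x)].  Expanding the squares and using that the
   characters are orthogonal,
     2^n PPtilde f (a, b) = E_{a',h,x,y} [chi_b(h) D_{a'} f(x+h) conj(D_{a'} f(x))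
                                    D_{a+a'} f(y+h) conj(D_{a+a'} f(y))],
   and for fixed [a] these numbers, over [b], are nonnegative with sum at most 1.
   So draw [a] uniformly and then O(n / xi^2) tuples [(a', h, x, y)]; the same 8
   values of [f] per tuple serve to estimate the expectation for all [b] at once,
   by a Hoeffding bound and a union bound over the 2^n values of [b].  Drawing
   [b] from the estimates, lowered a little and completed by the uniform
   distribution, gives an output law that is correct up to [xi / 2^n] at every
   point: the probability of bad estimates is absorbed in this error, and no
   conditioning is needed when [n > 1].  If [xi < 2 / 2^n], all of [f] can be queried. *)
Require Import Defs.
From HB Require Import structures.
From mathcomp Require Import all_boot all_order all_algebra.
From mathcomp Require Import sequences reals exp.
From mathcomp Require Import complex ring lra.
From mathcomp Require boolp.
Set Implicit Arguments.
Unset Strict Implicit.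
Unset Printing Implicit Defensive.
Import Order.TTheory GRing.Theory Num.Theory.
Local Open Scope ring_scope.

(** * Samplers and their output laws *)

Section Completion.
Variables (R : realType) (T : finType) (w : T -> R).

Definition subprob : bool := [forall z, 0 <= w z] && (\sum_z w z <= 1).

Definition subprob_part (z : T) : R := if subprob then w z else 0.

Lemma subprob_part_ge0 z : 0 <= subprob_part z.
Proof. by rewrite /subprob_part; case: ifP => [/andP[/forallP w0 _]|]. Qed.

Lemma subprob_part_sum : \sum_z subprob_part z <= 1.
Proof.
rewrite /subprob_part; case: (boolP subprob) => [/andP[_ ->]//|_].
by rewrite big1_eq ler01.
Qed.

Definition complete_pmf (z : T) : R :=
  subprob_part z + (1 - \sum_y subprob_part y) / #|T|%:R.

Lemma complete_pmf_ge0 z : 0 <= complete_pmf z.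
Proof.
by rewrite addr_ge0 ?subprob_part_ge0 // divr_ge0 // subr_ge0 subprob_part_sum.
Qed.

Lemma complete_pmf_sum1 : T -> \sum_z complete_pmf z = 1.
Proof.
move=> x0; rewrite big_split /= sumr_const -[X in _ + X]mulr_natr divfK ?subrKC //.
by rewrite pnatr_eq0 -lt0n; apply/card_gt0P; exists x0.
Qed.

(* The missing mass is spread uniformly; a [w] that is not a subprobability is
   replaced by [0], so that [complete] is total. *)
Definition complete (x0 : T) : fdist R T :=
  FDist complete_pmf_ge0 (complete_pmf_sum1 x0).

Lemma completeE x0 z : subprob ->
  complete x0 z = w z + (1 - \sum_y w y) / #|T|%:R.
Proof.
rewrite /= /complete_pmf /subprob_part.
by move=> ->.
Qed.

End Completion.

Definition uniform (R : realType) (T : finType) (x0 : T) : fdist R T :=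
  complete (fun=> 0) x0.

Lemma uniformE (R : realType) (T : finType) (x0 z : T) :
  uniform R x0 z = #|T|%:R^-1.
Proof.
rewrite completeE ?big1_eq ?subr0 ?add0r ?div1r //.
by apply/andP; split; [apply/forallP|rewrite big1_eq ler01].
Qed.

Section FdistOrd.
Variables (R : realType) (T : finType) (p : fdist R T).

Lemma fdist_ord_sum1 : \sum_(i < #|T|) p (enum_val i) = 1.
Proof. by rewrite -(pmf_sum1 p) -(big_enum_val (A := T) p). Qed.

Definition fdist_ord : fdist R 'I_#|T| :=
  FDist (fun i => pmf_ge0 p (enum_val i)) fdist_ord_sum1.

Lemma fdist_le1 z : p z <= 1.
Proof.
rewrite -(pmf_sum1 p) (bigD1 z) //= lerDl sumr_ge0 // => y _.
exact: pmf_ge0.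
Qed.

End FdistOrd.

Section Samplers.
Variables (R : realType) (X A : Type) (O : finType).
Implicit Types (t : sampler R X A O) (f : X -> A).

Definition prob_out t f (z : O) : R := Pr_run t f (fun _ o => o == z).

Lemma Pr_run_ge0 t f E : 0 <= Pr_run t f E.
Proof.
elim: t E => [o|x k IH|N p k IH] E /=; first exact: ler0n.
  exact: IH.
by apply: sumr_ge0 => i _; rewrite mulr_ge0 ?pmf_ge0.
Qed.

Lemma Pr_runT t f : Pr_run t f (fun _ _ => true) = 1.
Proof.
elim: t => [o|x k IH|N p k IH] //=.
by rewrite -(pmf_sum1 p); apply: eq_bigr => i _; rewrite IH mulr1.
Qed.

Lemma Pr_run0 t f : Pr_run t f (fun _ _ => false) = 0.
Proof.
elim: t => [o|x k IH|N p k IH] //=.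
by rewrite big1 // => i _; rewrite IH mulr0.
Qed.

Lemma prob_out_ge0 t f z : 0 <= prob_out t f z.
Proof. exact: Pr_run_ge0. Qed.

Lemma prob_out_sum1 t f : \sum_z prob_out t f z = 1.
Proof.
rewrite /prob_out; elim: t => [o|x k IH|N p k IH] //=.
  rewrite (bigD1 o) //= eqxx big1 ?addr0 // => z /negPf.
  by rewrite eq_sym => ->.
rewrite exchange_big /= -(pmf_sum1 p); apply: eq_bigr => i _.
by rewrite -mulr_sumr IH mulr1.
Qed.

Definition out_law t f : fdist R O :=
  FDist (prob_out_ge0 t f) (prob_out_sum1 t f).

Lemma samples_out_law t f q : q <= 1 -> samples_with_prob t f q (out_law t f).
Proof.
by move=> q1; exists xpredT; split=> [|z] /=; rewrite Pr_runT ?mul1r.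
Qed.

(** The conditioning event is empty, so both sides vanish for every [mu]. *)
Lemma samples_null t f mu : samples_with_prob t f 0 mu.
Proof. by exists xpred0; split=> [|z] /=; rewrite Pr_run0 ?mul0r. Qed.

Definition draw_from (T : finType) (p : fdist R T) (k : T -> sampler R X A O) :
    sampler R X A O :=
  Draw (fdist_ord p) (fun i => k (enum_val i)).

Lemma prob_out_draw (T : finType) (p : fdist R T) k f z :
  prob_out (draw_from p k) f z = \sum_x p x * prob_out (k x) f z.
Proof.
by rewrite /prob_out /= -(big_enum_val (A := T) (fun x => p x * prob_out (k x) f z)).
Qed.

Lemma nqueries_draw_le (T : finType) (p : fdist R T) k f m :
  (forall x, nqueries (k x) f <= m)%N -> (nqueries (draw_from p k) f <= m)%N.
Proof. by move=> km; apply/bigmax_leqP => i _. Qed.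

Lemma prob_out_draw_output (p : fdist R O) f z :
  prob_out (draw_from p (@Output R X A O)) f z = p z.
Proof.
rewrite prob_out_draw (bigD1 z) //= /prob_out /= eqxx mulr1 big1 ?addr0 //.
by move=> x /negPf ->; rewrite mulr0.
Qed.

End Samplers.

Section QueryAll.
Variables (R : realType) (X : eqType) (A : Type) (O : finType) (a0 : A).

(** The continuation receives a total function, with value [a0] off [s], so that it can be written
    as if it had [f] itself. *)
Fixpoint query_all (s : seq X) (k : (X -> A) -> sampler R X A O) :
    sampler R X A O :=
  if s is x :: s' then
    Query x (fun a => query_all s' (fun g => k (fun y => if y == x then a else g y)))
  else k (fun=> a0).

(** The existential [g] hides the default values. Each answer is stored inside the continuation, so
    the induction on [s] is for all [k]. *)
Lemma query_allP (s : seq X) k (f : X -> A) :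
  exists g, [/\ {in s, g =1 f},
    nqueries (query_all s k) f = (size s + nqueries (k g) f)%N &
    forall z, prob_out (query_all s k) f z = prob_out (k g) f z].
Proof.
elim: s k => [|x s IH] k /=; first by exists (fun=> a0).
have [g [gs q1 q2]] :=
  IH (fun g => k (fun y => if y == x then f x else g y)).
exists (fun y => if y == x then f x else g y); split.
- by move=> y; rewrite inE; case: eqP => [->|_] //= /gs.
- by rewrite q1.
- exact: q2.
Qed.

End QueryAll.

Lemma meas_dist_le (R : realType) (T : finType) (mu nu : T -> R) (c : R)
    (F : {set T}) :
  (forall z, `|mu z - nu z| <= c) -> `|meas mu F - meas nu F| <= c * #|F|%:R.
Proof.
move=> h; rewrite /meas -sumrB (le_trans (ler_norm_sum _ _ _)) //.
by rewrite mulr_natr -sumr_const ler_sum.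
Qed.

(** * A Hoeffding bound for independent uniform samples *)

(** From [expR (- t) >= 1 - t] one gets [expR t <= 1 / (1 - t)]; multiplying the quadratic by
    [1 - t] gives [1 + t ^+ 2 * (1 - 2 * t) >= 1]. *)
Lemma expR_le_quadratic (R : realType) (t : R) :
  t <= 2^-1 -> expR t <= 1 + t + 2 * t ^+ 2.
Proof.
move=> t2; have := expR_ge1Dx (- t); rewrite expRN => h.
have e0 := expR_gt0 t.
have q0 : 0 <= 1 + t + 2 * t ^+ 2 by nra.
have t1 : 0 < 1 - t by lra.
have : expR t * (1 - t) <= 1.
  by have := ler_wpM2l (ltW e0) h; rewrite mulfV // lt0r_neq0.
move=> h1; rewrite -(ler_pM2r t1) (le_trans h1) //.
have -> : (1 + t + 2 * t ^+ 2) * (1 - t) = 1 + t ^+ 2 * (1 - 2 * t) by ring.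
by rewrite lerDl mulr_ge0 ?sqr_ge0 //; lra.
Qed.

Lemma expR_sum (R : realType) (I : finType) (F : I -> R) :
  expR (\sum_i F i) = \prod_i expR (F i).
Proof. by apply: (big_morph expR (@expRD R) (@expR0 R)). Qed.

(** Exponential Markov inequality, with the probability of a deviation expressed as a count of
    sample tuples [w]. *)
Lemma hoeffding (R : realType) (T : finType) (m : nat) (Z : T -> R) (eps : R) :
  0 < eps -> eps <= 1 -> \sum_x Z x = 0 -> (forall x, `|Z x| <= 2) ->
  #|[set w : {ffun 'I_m -> T} | m%:R * eps <= \sum_i Z (w i)]|%:R <=
    #|T|%:R ^+ m * expR (- (m%:R * eps ^+ 2 / 32)).
Proof.
move=> e0 e1 Z0 Z2; set B := [set w | _].
(* Chernoff: [lam] is (up to a constant) the minimizer of the final exponent. *)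
pose lam := eps / 16.
have l0 : 0 <= lam by rewrite /lam; lra.
have mgf : \sum_x expR (lam * Z x) <= #|T|%:R * expR (8 * lam ^+ 2).
  apply: (@le_trans _ _ (\sum_x (1 + lam * Z x + 8 * lam ^+ 2))).
    apply: ler_sum => x _; have := Z2 x; rewrite ler_norml => /andP[z1 z2].
    have zl : lam * Z x <= 2^-1 by rewrite /lam; nra.
    apply: le_trans (expR_le_quadratic zl) _; rewrite lerD2l exprMn.
    have : Z x ^+ 2 <= 4 by nra.
    by move: (sqr_ge0 lam); nra.
  rewrite !big_split /= -mulr_sumr Z0 mulr0 addr0 !sumr_const.
  rewrite -[X in _ + X <= _]mulr_natl -[X in X + _]mulr1 -mulrDr ler_wpM2l //.
  exact: expR_ge1Dx.
have lhs : #|B|%:R <= \sum_(w : {ffun 'I_m -> T})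
    expR (lam * (\sum_i Z (w i) - m%:R * eps)).
  rewrite -sum1_card natr_sum big_mkcond /=; apply: ler_sum => w _.
  case: ifP => [|_]; last exact: expR_ge0.
  by rewrite inE -expR0 ler_expR => h; rewrite mulr_ge0 ?subr_ge0.
apply: (le_trans lhs).
(* Independence: distributing a product of [m] sums over [T] yields one sum over all [w]. *)
have -> : \sum_(w : {ffun 'I_m -> T}) expR (lam * (\sum_i Z (w i) - m%:R * eps))
    = expR (- (lam * (m%:R * eps))) * (\sum_x expR (lam * Z x)) ^+ m.
  have -> : (\sum_x expR (lam * Z x)) ^+ m =
      \prod_(i < m) \sum_x expR (lam * Z x) by rewrite prodr_const card_ord.
  rewrite bigA_distr_bigA mulr_sumr; apply: eq_bigr => w _.
  by rewrite mulrBr addrC expRD mulr_sumr expR_sum.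
apply: (@le_trans _ _ (expR (- (lam * (m%:R * eps))) *
    (#|T|%:R * expR (8 * lam ^+ 2)) ^+ m)).
  rewrite ler_wpM2l ?expR_ge0 // lerXn2r ?nnegrE ?mulr_ge0 ?expR_ge0 //.
  by apply: sumr_ge0 => x _; exact: expR_ge0.
rewrite exprMn mulrCA -expRM_natl -expRD ler_wpM2l ?exprn_ge0 // ler_expR.
(* The exponent is [m (8 lam^2 - lam eps) = m eps^2 (1/32 - 1/16)]. *)
rewrite /lam.
by rewrite le_eqVlt; apply/orP; left; apply/eqP; field.
Qed.

(** * The self-convolution of Ptilde as an expectation *)

Section Fourier.
Variables (R : realType) (n : nat).
Implicit Types (f g : F2 n -> R[i]) (a b h x y : F2 n).

Local Notation chi b x := ((-1) ^+ (dotp b x : nat) : R[i]).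
Local Notation conj := (@conjc R).

Lemma F2_addrr x : x + x = 0.
Proof. by apply/rowP => i; rewrite !mxE addrr_pchar2 // pchar_Fp. Qed.

Lemma F2_addrK x y : y + x + x = y.
Proof. by rewrite -addrA F2_addrr addr0. Qed.

Lemma sign_F2D (u v : 'F_2) :
  (-1) ^+ nat_of_ord (u + v)%R = (-1) ^+ (u : nat) * (-1) ^+ (v : nat) :> R[i].
Proof.
case: u => [[|[|[]]]] // i; case: v => [[|[|[]]]] // j;
  by rewrite /= ?expr0 ?expr1 ?mulr1 ?mul1r ?mulrNN ?mulr1.
Qed.

Lemma chiDr b x y : chi b (x + y) = chi b x * chi b y.
Proof.
rewrite -sign_F2D; congr ((-1) ^+ (nat_of_ord _)).
by rewrite /dotp -big_split /=; apply: eq_bigr => i _; rewrite mxE mulrDr.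
Qed.

Lemma chiDl a b x : chi (a + b) x = chi a x * chi b x.
Proof.
rewrite -sign_F2D; congr ((-1) ^+ (nat_of_ord _)).
by rewrite /dotp -big_split /=; apply: eq_bigr => i _; rewrite mxE mulrDl.
Qed.

Lemma chi0 b : chi b 0 = 1.
Proof. by rewrite /dotp big1 ?expr0 // => i _; rewrite mxE mulr0. Qed.

Lemma conj_chi b x : conj (chi b x) = chi b x.
Proof. by rewrite rmorphXn rmorphN1. Qed.

Lemma normr_chi b x : `|chi b x| = 1.
Proof. by rewrite normrX normrN1 expr1n. Qed.

Lemma card_F2 : #|{: F2 n}| = (2 ^ n)%N.
Proof. by rewrite card_mx mul1n card_Fp. Qed.

(** If [x] has a coordinate equal to 1, shifting [b] by that unit vector flips every sign, so the
    sum equals its negative. *)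
Lemma sum_chi x : \sum_b chi b x = 2 ^+ n * (x == 0)%:R.
Proof.
have [->|x0] := eqVneq x 0.
  rewrite mulr1 (eq_bigr (fun=> 1)) => [|b _]; last exact: chi0.
  by rewrite sumr_const card_F2 natrX.
have [i xi] : exists i, x 0 i != 0.
  apply/existsP; rewrite -negb_forall; apply: contra x0 => /forallP x0.
  by apply/eqP/rowP => i; rewrite mxE; apply/eqP.
have xi1 : x 0 i = 1.
  by apply/val_inj; case: (x 0 i) xi => [[|[|[]]]].
pose e : F2 n := delta_mx 0 i.
have dotpe : dotp e x = 1.
  rewrite /dotp (bigD1 i) //= [X in _ + X]big1 => [|j /negPf ji].
    by rewrite mxE !eqxx xi1 mulr1 addr0.
  by rewrite mxE ji andbF mul0r.
have chie : chi e x = -1 by rewrite dotpe expr1.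
rewrite mulr0; set S := \sum_b _.
have : S = - S.
  rewrite {1}/S (reindex_inj (addIr e)) /= -sumrN.
  by apply: eq_bigr => b _; rewrite chiDl chie mulrN1.
by move/eqP; rewrite -addr_eq0 -mulr2n mulrn_eq0 => /eqP.
Qed.

Definition corr g h : R[i] := \sum_x g (x + h) * conj (g x).

(** Wiener-Khinchin: the power spectrum is the transform of the autocorrelation [corr]. Substitute
    [x = x' + h] in the double sum; [chi b x'] then occurs squared and disappears. *)
Lemma sqr_fourier g b :
  ((ComplexField.Normc.normc (fourier g b) ^+ 2)%:C)%C =
  (2 ^+ n)^-1 ^+ 2 * \sum_h chi b h * corr g h.
Proof.
rewrite rmorphXn /=.
have -> : ((ComplexField.Normc.normc (fourier g b))%:C)%C = `|fourier g b| by [].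
rewrite sqr_normc /fourier rmorphM /= mulrACA.
have -> : conj ((2 ^+ n)^-1) = (2 ^+ n)^-1.
  by rewrite conjc_inv -natrX conjc_nat.
rewrite -expr2; congr (_ * _).
rewrite rmorph_sum mulr_suml.
transitivity (\sum_x' \sum_x (g x * chi b x) * conj (g x' * chi b x')).
  by rewrite exchange_big; apply: eq_bigr => x _ /=; rewrite mulr_sumr.
transitivity (\sum_x' \sum_h chi b h * (g (x' + h) * conj (g x'))); last first.
  by rewrite exchange_big; apply: eq_bigr => h _ /=; rewrite mulr_sumr.
apply: eq_bigr => x' _; rewrite (reindex_inj (addrI x')) /=.
apply: eq_bigr => h _; rewrite rmorphM /= conj_chi chiDr.
have : chi b x' * chi b x' = 1 by rewrite -chiDr F2_addrr chi0.
move: (chi b x') (chi b h) (g _) (conj _) => c d u v c1.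
by rewrite -[RHS]mul1r -[X in _ = X * _]c1; ring.
Qed.

(* [s] is [((a', h), (x, y))]. *)
Definition summand f a b (s : F2 n * F2 n * (F2 n * F2 n)) : R[i] :=
  chi b s.1.2 *
  (mderiv s.1.1 f (s.2.1 + s.1.2) * conj (mderiv s.1.1 f s.2.1)) *
  (mderiv (a + s.1.1) f (s.2.2 + s.1.2) * conj (mderiv (a + s.1.1) f s.2.2)).

(** For fixed [a'] and [h] the sums over [x] and [y] separate. *)
Lemma sum_summand f a b :
  \sum_s summand f a b s =
  \sum_a' \sum_h chi b h * corr (mderiv a' f) h * corr (mderiv (a + a') f) h.
Proof.
rewrite (pair_bigA _ (fun a' h => chi b h * corr (mderiv a' f) h *
  corr (mderiv (a + a') f) h)) /=.
rewrite -(pair_bigA _ (fun p q => summand f a b (p, q))) /=.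
apply: eq_bigr => p _.
rewrite -(pair_bigA _ (fun x y => summand f a b (p, (x, y)))) /=.
rewrite /corr [X in _ = X * _]mulr_sumr mulr_suml; apply: eq_bigr => x _.
by rewrite mulr_sumr.
Qed.

(** Each [Ptilde] contributes [2^(-3n)] and a sum over a shift, [h] or [k]. Summing over [b'] forces
    [k = h] and returns a factor [2^n]. The resulting [2^(-5n)] is [2^(-n)] times the normalization
    of a mean over [2^(4n)] tuples. *)
Lemma PPtilde_expect f a b :
  ((PPtilde f (a, b))%:C)%C = (2 ^+ n)^-1 ^+ 5 * \sum_s summand f a b s.
Proof.
rewrite sum_summand /PPtilde /convol.
rewrite -(pair_bigA _ (fun a' b' => Ptilde f (a', b') * Ptilde f ((a, b) + (a', b')))) /=.
rewrite rmorph_sum mulr_sumr; apply: eq_bigr => a' _ /=.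
have PE c d : ((Ptilde f (c, d))%:C)%C =
    (2 ^+ n)^-1 ^+ 3 * \sum_h chi d h * corr (mderiv c f) h.
  rewrite /Ptilde rmorphM /= sqr_fourier fmorphV rmorphXn /= rmorph_nat.
  by rewrite mulrA -exprS.
set G := corr (mderiv a' f); set K := corr (mderiv (a + a') f).
have n2 : 2 ^+ n != 0 :> R[i] by rewrite expf_eq0 pnatr_eq0 andbF.
transitivity (\sum_b' (2 ^+ n)^-1 ^+ 6 *
    \sum_h \sum_k chi b' (h + k) * (chi b k * G h * K k)).
  rewrite rmorph_sum; apply: eq_bigr => b' _ /=.
  rewrite rmorphM /= !PE mulrACA -exprD mulr_suml; congr (_ * _).
  apply: eq_bigr => h _; rewrite mulr_sumr; apply: eq_bigr => k _.
  rewrite chiDr chiDl -/G -/K.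
  by move: (chi b' h) (chi b' k) (chi b k) (G h) (K k) => c d e u v; ring.
rewrite -mulr_sumr exchange_big /=.
have -> : \sum_h \sum_b' \sum_k chi b' (h + k) * (chi b k * G h * K k) =
    2 ^+ n * \sum_h chi b h * G h * K h.
  rewrite mulr_sumr; apply: eq_bigr => h _; rewrite exchange_big /=.
  rewrite (bigD1 h) //= [X in _ + X]big1 ?addr0 => [|k kh].
    by rewrite -mulr_suml sum_chi F2_addrr eqxx mulr1.
  rewrite -mulr_suml sum_chi; case: eqP => [|_]; last by rewrite mulr0 mul0r.
  by move=> hk; case/eqP: kh; rewrite -[k](F2_addrK h) [k + h]addrC hk add0r.
by rewrite mulrA [_ ^+ 6]exprSr -[_ * _ * 2 ^+ n]mulrA mulVf // mulr1.
Qed.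

End Fourier.

(** * Real parts, and the subprobabilities obtained by fixing [a] *)

Lemma Re_sum (R : realType) (I : finType) (F : I -> R[i]) :
  complex.Re (\sum_i F i) = \sum_i complex.Re (F i).
Proof. by apply: big_morph => // -[? ?] [? ?]. Qed.

Lemma Re_realM (R : realType) (c : R) (z : R[i]) :
  complex.Re ((c%:C)%C * z) = c * complex.Re z.
Proof. by case: z => u v; rewrite /= mul0r subr0. Qed.

Lemma Re_le1 (R : realType) (z : R[i]) : `|z| <= 1 -> `|complex.Re z| <= 1.
Proof. by move/(le_trans (normc_ge_Re z)); rewrite -(lecR _ 1). Qed.

Lemma exprn2_gt0 (R : realType) n : 0 < 2 ^+ n :> R.
Proof. by rewrite exprn_gt0. Qed.

Section Slices.
Variables (R : realType) (n : nat) (f : F2 n -> R[i]).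
Hypothesis f1 : forall x, `|f x| <= 1.
Local Notation quad := (F2 n * F2 n * (F2 n * F2 n))%type.

(* The subprobability on [b] to be sampled from once [a] is drawn uniformly. *)
Definition slice (a b : F2 n) : R := 2 ^+ n * PPtilde f (a, b).

Lemma normr_mderiv a x : `|mderiv a f x| <= 1.
Proof. by rewrite /mderiv normrM normcJ mulr_ile1. Qed.

Lemma normr_corr_term a h x : `|mderiv a f (x + h) * (mderiv a f x)^*%C| <= 1.
Proof. by rewrite normrM normcJ mulr_ile1 ?normr_mderiv. Qed.

Lemma Re_summand_le1 a b s : `|complex.Re (summand f a b s)| <= 1.
Proof.
apply: Re_le1; rewrite /summand 2!normrM normr_chi mul1r.
by rewrite mulr_ile1 ?normr_corr_term.
Qed.

(** The left side is real, so imaginary parts cancel and the estimator may average real parts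
    only. *)
Lemma PPtilde_Re a b :
  PPtilde f (a, b) = (2 ^+ n)^-1 ^+ 5 * \sum_s complex.Re (summand f a b s).
Proof.
have := congr1 (@complex.Re R) (PPtilde_expect f a b) => /= ->.
have -> : (2 ^+ n)^-1 ^+ 5 = (((2 ^+ n)^-1 ^+ 5 : R)%:C)%C :> R[i].
  by rewrite rmorphXn /= fmorphV rmorphXn /= rmorph_nat.
by rewrite Re_realM Re_sum.
Qed.

Lemma slice_expect a b :
  slice a b = (2 ^+ n)^-1 ^+ 4 * \sum_s complex.Re (summand f a b s).
Proof.
rewrite /slice PPtilde_Re [_ ^+ 5]exprS -mulrA mulVKf //.
by rewrite lt0r_neq0 ?exprn2_gt0.
Qed.

Lemma slice_ge0 a b : 0 <= slice a b.
Proof. by rewrite mulr_ge0 ?PPtilde_ge0 // ltW ?exprn2_gt0. Qed.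

(** Summing over [b] first leaves the [2^(3n)] tuples with [h = 0], each contributing at most [2^n];
    this cancels the normalization [2^(-4n)]. *)
Lemma sum_slice_le1 a : \sum_b slice a b <= 1.
Proof.
have n2 := lt0r_neq0 (exprn2_gt0 R n).
rewrite (eq_bigr _ (fun b _ => slice_expect a b)) -mulr_sumr exchange_big /=.
apply: (@le_trans _ _ ((2 ^+ n)^-1 ^+ 4 *
    \sum_(s : quad) 2 ^+ n * (s.1.2 == 0)%:R)).
  rewrite ler_wpM2l ?exprn_ge0 ?invr_ge0 ?exprn_ge0 // ler_sum // => s _.
  rewrite -Re_sum /summand -!mulr_suml sum_chi.
  set u := _ * (_)^*%C; set v := _ * (_)^*%C.
  have -> : 2 ^+ n * (s.1.2 == 0)%:R * u * v =
      ((2 ^+ n * (s.1.2 == 0)%:R : R)%:C)%C * (u * v).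
    by rewrite rmorphM /= rmorphXn /= !rmorph_nat mulrA.
  rewrite Re_realM ler_piMr ?mulr_ge0 ?exprn_ge0 ?ler0n //.
  have : `|complex.Re (u * v)| <= 1.
    by apply: Re_le1; rewrite normrM mulr_ile1 ?normr_corr_term.
  by rewrite ler_norml => /andP[].
rewrite -mulr_sumr.
have -> : \sum_(s : quad) (s.1.2 == 0)%:R = (2 ^+ n) ^+ 3 :> R.
  rewrite -(pair_bigA _ (fun (p q : F2 n * F2 n) => (p.2 == 0)%:R)) /=.
  rewrite -(pair_bigA _ (fun (x h : F2 n) =>
    \sum_(q : F2 n * F2 n) (h == 0)%:R)) /=.
  rewrite (eq_bigr (fun=> (2 ^+ n) ^+ 2)) => [|x _].
    by rewrite sumr_const card_F2 -[LHS]mulr_natl natrX -exprS.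
  rewrite (bigD1 0) //= eqxx [X in _ + X]big1 => [|h /negPf ->].
    by rewrite addr0 sumr_const card_prod card_F2 natrM natrX.
  by rewrite big1.
by rewrite -exprS -exprMn mulVf // expr1n.
Qed.

Lemma slice_le1 a b : slice a b <= 1.
Proof.
apply: le_trans (sum_slice_le1 a); rewrite (bigD1 b) //= lerDl sumr_ge0 //.
by move=> c _; exact: slice_ge0.
Qed.

Lemma PPtilde_slice a b : PPtilde f (a, b) = (2 ^+ n)^-1 * slice a b.
Proof. by rewrite /slice mulKf // lt0r_neq0 ?exprn2_gt0. Qed.

Lemma sum_PPtilde_le1 : \sum_z PPtilde f z <= 1.
Proof.
rewrite -(pair_bigA _ (fun a b => PPtilde f (a, b))) /=.
apply: (@le_trans _ _ (\sum_(a : F2 n) (2 ^+ n)^-1)).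
  apply: ler_sum => a _; rewrite (eq_bigr _ (fun b _ => PPtilde_slice a b)).
  by rewrite -mulr_sumr ler_piMr ?sum_slice_le1 ?invr_ge0 ?exprn_ge0.
by rewrite sumr_const card_F2 -[_ *+ _]mulr_natl natrX mulfV // lt0r_neq0 ?exprn2_gt0.
Qed.

Lemma PPtilde_subprob : subprob (PPtilde f).
Proof.
by apply/andP; split; [apply/forallP => z; apply: PPtilde_ge0|exact: sum_PPtilde_le1].
Qed.

(** Completion adds the missing mass divided by [4^n] at each point, and [mass_condition] bounds
    exactly this by [xi / 2^n]. *)
Lemma complete_PPtilde_close xi z : mass_condition f xi ->
  `|complete (PPtilde f) 0 z - PPtilde f z| <= xi / 2 ^+ n.
Proof.
move=> mc; rewrite completeE ?PPtilde_subprob // addrC addKr.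
have N0 : 0 < #|{: F2 n * F2 n}|%:R :> R.
  by rewrite ltr0n; apply/card_gt0P; exists 0.
rewrite ger0_norm; last by rewrite divr_ge0 ?subr_ge0 ?sum_PPtilde_le1 // ltW.
rewrite ler_pdivrMr //; move: mc; rewrite /mass_condition cardsT mulrAC.
congr (1 - _ <= _); apply: eq_bigl => y; by rewrite inE.
Qed.

End Slices.

(** * The sampler *)

Section Estimates.
Variables (R : realType) (n m : nat).
Hypothesis m0 : (0 < m)%N.
Local Notation quad := (F2 n * F2 n * (F2 n * F2 n))%type.
Implicit Types (f g : F2 n -> R[i]) (a b : F2 n) (w : {ffun 'I_m -> quad}).

Definition query_points a (s : quad) : seq (F2 n) :=
  let: ((c, h), (x, y)) := s in
  [:: x + h + c; x + h; x + c; x;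
      y + h + (a + c); y + h; y + (a + c); y].

Definition all_query_points a w : seq (F2 n) :=
  flatten [seq query_points a (w i) | i <- enum 'I_m].

Lemma size_all_query_points a w : size (all_query_points a w) = (8 * m)%N.
Proof.
rewrite size_flatten sumnE 2!big_map big_enum /= (eq_bigr (fun=> 8)) => [|i _].
  by rewrite sum_nat_const card_ord mulnC.
by case: (w i) => [[? ?] [? ?]].
Qed.

Lemma summand_local f g a b s :
  {in query_points a s, g =1 f} -> summand g a b s = summand f a b s.
Proof.
case: s => [[c h] [x y]] gf; rewrite /summand /mderiv /=.
by rewrite !gf // !inE eqxx ?orbT.
Qed.

Definition estimate f a w b : R :=
  (\sum_i complex.Re (summand f a b (w i))) / m%:R.

(** The query points do not involve [b], so a [g] that agrees with [f] on them gives the right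
    estimates at all frequencies. *)
Lemma estimate_local f g a w b :
  {in all_query_points a w, g =1 f} -> estimate g a w b = estimate f a w b.
Proof.
move=> gf; congr (_ / _); apply: eq_bigr => i _; congr complex.Re.
apply: summand_local => x xi; apply: gf; apply/flatten_mapP.
by exists i; rewrite ?mem_enum.
Qed.

(* Lowering the estimates by [eps] makes them underestimates of [slice], hence
   a subprobability. *)
Definition guess f (eps : R) a w b : R := Num.max 0 (estimate f a w b - eps).

Definition bad f (eps : R) a : {set {ffun 'I_m -> quad}} :=
  [set w | [exists b, eps < `|estimate f a w b - slice f a b|]].

Section Bounded.
Variables (f : F2 n -> R[i]) (eps : R).
Hypothesis f1 : forall x, `|f x| <= 1.

Lemma card_quad : #|{: quad}| = ((2 ^ n) ^ 4)%N.
Proof. by rewrite !card_prod card_F2 !expnS expn0 muln1 !mulnA. Qed.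

(** Hoeffding for the centred summand and its negative accounts for the factor 2, the union bound
    over [b] for [2^n]. *)
Lemma card_bad a : 0 < eps -> eps <= 1 ->
  #|bad f eps a|%:R <= #|{: quad}|%:R ^+ m *
     (2 * 2 ^+ n * expR (- (m%:R * eps ^+ 2 / 32))).
Proof.
move=> e0 e1; have m0' : 0 < m%:R :> R by rewrite ltr0n.
pose Z b (s : quad) := complex.Re (summand f a b s) - slice f a b.
pose over (Y : quad -> R) := [set w : {ffun 'I_m -> quad} | m%:R * eps <= \sum_i Y (w i)].
have Z0 b : \sum_s Z b s = 0.
  rewrite sumrB sumr_const slice_expect // -[X in _ - X]mulr_natl mulrA card_quad.
  rewrite natrX -[_ * _ ^+ 4]mulrC natrX -exprMn mulVf ?expr1n ?mul1r ?subrr //.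
  by rewrite lt0r_neq0 ?exprn2_gt0.
have Z2 b s : `|Z b s| <= 2.
  rewrite (le_trans (ler_normB _ _)) // (_ : 2 = 1 + 1) // lerD ?Re_summand_le1 //.
  by rewrite ger0_norm ?slice_ge0 ?slice_le1.
have Zm b w : \sum_i Z b (w i) = m%:R * (estimate f a w b - slice f a b).
  rewrite sumrB sumr_const card_ord -[X in _ - X]mulr_natl mulrBr; congr (_ - _).
  by rewrite /estimate mulrC divfK // lt0r_neq0.
pose E := #|{: quad}|%:R ^+ m * expR (- (m%:R * eps ^+ 2 / 32)).
have over_le b : #|over (Z b)|%:R <= E /\ #|over (fun s => - Z b s)|%:R <= E.
  split; apply: hoeffding => //; first by rewrite sumrN Z0 oppr0.
  by move=> s; rewrite normrN.
have cover : (#|bad f eps a| <= \sum_b (#|over (Z b)| + #|over (fun s => - Z b s)%R|))%N.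
  have sub : bad f eps a \subset \bigcup_b (over (Z b) :|: over (fun s => - Z b s)).
    apply/subsetP => w; rewrite inE => /existsP[b wb]; apply/bigcupP; exists b => //.
    rewrite !inE sumrN Zm; move: wb; set d := _ - slice f a b => wb.
    rewrite -[X in _ || (_ <= X)]mulrN !ler_pM2l //.
    by move: wb; rewrite lter_normr => /orP[] /ltW ->; rewrite ?orbT.
  apply: (leq_trans (subset_leq_card sub)).
  elim/big_ind2: _ => [|A1 k1 A2 k2 h1 h2|b _]; first by rewrite cards0.
    by rewrite (leq_trans (leq_card_setU _ _)) // leq_add.
  exact: leq_card_setU.
have : #|bad f eps a|%:R <= \sum_(b : F2 n) (E + E).
  rewrite (@le_trans _ _ (\sum_b (#|over (Z b)| + #|over (fun s => - Z b s)|))%:R) //.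
    by rewrite ler_nat.
  by rewrite natr_sum ler_sum // => b _; have [? ?] := over_le b; rewrite natrD lerD.
move/le_trans; apply; rewrite sumr_const card_F2 -[_ *+ _]mulr_natl natrX /E.
by rewrite le_eqVlt; apply/orP; left; apply/eqP; ring.
Qed.

(** The guess lies below [slice] by at most [2 * eps], and completion raises it by at most [2^(-n)].
    These errors have opposite signs, so [c] need only dominate each of them, not their sum. *)
Lemma guess_close a w b c :
  0 <= eps -> 2 * eps <= c -> (2 ^+ n)^-1 <= c -> w \notin bad f eps a ->
  `|complete (guess f eps a w) 0 b - slice f a b| <= c.
Proof.
move=> e0 ec nc; rewrite inE negb_exists => /forallP good.
have gs d : slice f a d - 2 * eps <= guess f eps a w d <= slice f a d.
  have := good d; rewrite -leNgt ler_norml => /andP[h1 h2].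
  have := slice_ge0 f a d => s0.
  (* Truncation at 0 preserves the upper bound because [slice] is nonnegative. *)
  by rewrite /guess; case: (leP 0 (estimate f a w d - eps)) => h3; apply/andP; split; lra.
have g0 d : 0 <= guess f eps a w d by rewrite /guess le_max lexx.
have gsum : \sum_d guess f eps a w d <= 1.
  apply: le_trans (sum_slice_le1 f1 a); apply: ler_sum => d _.
  by have /andP[] := gs d.
rewrite completeE; last by apply/andP; split=> //; apply/forallP.
set rest := _ / _.
have r0 : 0 <= rest by rewrite divr_ge0 ?subr_ge0.
have r1 : rest <= (2 ^+ n)^-1.
  rewrite /rest card_F2 natrX ler_piMl ?invr_ge0 ?exprn_ge0 // gerBl.
  by apply: sumr_ge0.
have /andP[] := gs b => g1 g2.
by rewrite ler_norml; apply/andP; split; lra.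
Qed.


(** All tuples are drawn before any query, so the average over the randomness is a plain sum over
    [w]. *)
Definition slice_sampler a : sampler R (F2 n) R[i] (F2 n * F2 n)%type :=
  draw_from (@uniform R {ffun 'I_m -> quad} [ffun=> 0]) (fun w =>
  query_all 0 (all_query_points a w) (fun g =>
  draw_from (complete (guess g eps a w) 0) (fun b => Output _ _ _ (a, b)))).

Definition main_sampler : sampler R (F2 n) R[i] (F2 n * F2 n)%type :=
  draw_from (@uniform R (F2 n) 0) slice_sampler.

Lemma nqueries_main : (nqueries main_sampler f <= 8 * m)%N.
Proof.
apply: nqueries_draw_le => a; apply: nqueries_draw_le => w.
have [g [_ -> _]] := query_allP 0 (all_query_points a w) (fun g =>
  draw_from (complete (guess g eps a w) 0) (fun b => Output _ _ _ (a, b))) f.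
rewrite size_all_query_points -[leqRHS]addn0 leq_add2l.
exact: nqueries_draw_le.
Qed.

Lemma prob_out_slice_sampler a z :
  prob_out (slice_sampler a) f z =
  (z.1 == a)%:R * (#|{: quad}|%:R ^- m *
    \sum_(w : {ffun 'I_m -> quad}) complete (guess f eps a w) 0 z.2).
Proof.
rewrite prob_out_draw !mulr_sumr; apply: eq_bigr => w _.
rewrite uniformE card_ffun card_ord natrX.
have [g [gf _ ->]] := query_allP 0 (all_query_points a w) (fun g =>
  draw_from (complete (guess g eps a w) 0) (fun b => Output _ _ _ (a, b))) f.
rewrite mulrCA; congr (_ * _); rewrite prob_out_draw.
have -> : guess g eps a w = guess f eps a w.
  by apply/boolp.funext => b; rewrite /guess (estimate_local b gf).
case: z => a' b' /=; rewrite (bigD1 b') //= big1 ?addr0 => [|b bb'].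
  by rewrite /prob_out /= xpair_eqE eqxx andbT mulrC eq_sym.
by rewrite /prob_out /= xpair_eqE (negPf bb') andbF mulr0.
Qed.

(** Averaging over [w], good tuples err by at most [c] and bad ones by at most 1, so the fraction of
    bad tuples is simply added to the error. *)
Lemma main_sampler_close c z : 0 < eps -> eps <= 1 ->
  2 * eps <= c -> (2 ^+ n)^-1 <= c ->
  `|prob_out main_sampler f z - PPtilde f z| <=
    (2 ^+ n)^-1 * (c + 2 * 2 ^+ n * expR (- (m%:R * eps ^+ 2 / 32))).
Proof.
case: z => a b e0 e1 ec nc.
have q0 : 0 < #|{: quad}|%:R :> R by rewrite card_quad ltr0n !expn_gt0.
have qm0 : 0 < #|{: quad}|%:R ^+ m :> R by rewrite exprn_gt0.
have c0 : 0 <= c by lra.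
pose nu w := complete (guess f eps a w) 0 b.
have -> : prob_out main_sampler f (a, b) =
    (2 ^+ n)^-1 * (#|{: quad}|%:R ^- m * \sum_w nu w).
  rewrite prob_out_draw; under eq_bigr => a' _ do
    rewrite uniformE prob_out_slice_sampler card_F2 natrX.
  rewrite (bigD1 a) //= eqxx mul1r [X in _ + X]big1 ?addr0 // => a'.
  by rewrite eq_sym => /negPf ->; rewrite mul0r mulr0.
rewrite PPtilde_slice -mulrBr normrM ger0_norm ?invr_ge0 ?exprn_ge0 //.
rewrite ler_wpM2l ?invr_ge0 ?exprn_ge0 //.
have -> : #|{: quad}|%:R ^- m * \sum_w nu w - slice f a b =
    #|{: quad}|%:R ^- m * \sum_w (nu w - slice f a b).
  rewrite sumrB sumr_const card_ffun card_ord mulrBr -[X in _ = _ - _ * X]mulr_natl natrX.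
  by rewrite mulKf // lt0r_neq0.
rewrite normrM ger0_norm ?invr_ge0 ?exprn_ge0 ?ler0n // mulrC ler_pdivrMr //.
apply: le_trans (ler_norm_sum _ _ _) _.
apply: (@le_trans _ _ (\sum_(w : {ffun 'I_m -> quad}) (c + (w \in bad f eps a)%:R))).
  apply: ler_sum => w _; have [wb|wb] := boolP (w \in _); last first.
    by rewrite addr0; apply: guess_close => //; exact: ltW.
  (* Both numbers lie in [[0, 1]]. *)
  have : `|nu w - slice f a b| <= 1.
    have := fdist_le1 (complete (guess f eps a w) 0) b.
    have := pmf_ge0 (complete (guess f eps a w) 0) b.
    have := slice_ge0 f a b; have := slice_le1 f1 a b.
    by rewrite -/(nu w) ler_norml => ? ? ? ?; apply/andP; split; lra.
  by move=> h; rewrite (le_trans h) //= lerDr.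
rewrite big_split /= sumr_const card_ffun card_ord -[X in X + _]mulr_natl natrX.
rewrite -natr_sum -big_mkcond sum1_card mulrDl [_ * c]mulrC lerD2l mulrC.
exact: card_bad.
Qed.

End Bounded.
End Estimates.

(** * Choice of parameters and the cases for [n] and [xi] *)

Lemma expRN_nat_le (R : realType) (k : nat) (t : R) :
  k%:R <= t -> expR (- t) <= (2 ^+ k)^-1.
Proof.
move=> kt; rewrite expRN lef_pV2 ?posrE ?expR_gt0 ?exprn_gt0 //.
apply: le_trans (_ : expR k%:R <= _); last by rewrite ler_expR.
rewrite -[k%:R]mulr1 expRM_natl lerXn2r ?nnegrE ?expR_ge0 //.
exact: expR_ge1Dx.
Qed.

(** Converts query bounds linear in [n] into multiples of [n * ln n]. *)
Lemma ln_nat_ge_half (R : realType) n : (1 < n)%N -> 2^-1 <= ln n%:R :> R.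
Proof.
move=> n1; have n0 : 0 < n%:R :> R by rewrite ltr0n ltnW.
rewrite -ler_expR lnK ?posrE //.
have := expR_ge1Dx (- 2^-1 : R); rewrite expRN => h.
have e0 := expR_gt0 (2^-1 : R).
have := ler_wpM2l (ltW e0) h; rewrite mulfV ?lt0r_neq0 // => h2.
have : 2 <= n%:R :> R by rewrite ler_nat.
by lra.
Qed.

Lemma sampler_accurate (R : realType) (n : nat) (xi : R) :
  (1 < n)%N -> 0 < xi -> (2 ^+ n)^-1 <= xi / 2 ->
  exists t : sampler R (F2 n) R[i] (F2 n * F2 n)%type,
  forall f : F2 n -> R[i], (forall x, `|f x| <= 1) ->
    (nqueries t f)%:R <= n%:R * (2 ^+ 14 * (xi^-1 ^+ 2 + 2)) /\
    forall z, `|prob_out t f z - PPtilde f z| <= xi / 2 ^+ n.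
Proof.
move=> n1 xi0 xin.
(* The minimum ensures [eps <= 1] for Hoeffding; the 4 makes [2 * eps] at most half of the error
   budget [xi]. *)
pose eps := Num.min xi 1 / 4.
have e0 : 0 < eps by rewrite divr_gt0 // lt_min xi0 ltr01.
have e1 : eps <= 1.
  have : Num.min xi 1 <= 1 by rewrite ge_min lexx orbT.
  by rewrite /eps; lra.
have exi : 2 * eps <= xi / 2.
  have : Num.min xi 1 <= xi by rewrite ge_min lexx.
  by rewrite /eps; lra.
have einv : (eps ^+ 2)^-1 <= 16 * (xi^-1 ^+ 2 + 1).
  rewrite -exprVn; have x2 : 0 <= xi^-1 ^+ 2 by rewrite sqr_ge0.
  rewrite /eps; case: (leP xi 1) => _; rewrite invfM invrK exprMn ?invr1 ?expr1n; lra.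
(* [2 n + 3] pays for the union bound over [2 ^ n] frequencies and for a failure
   probability of order [2 ^ - n <= xi / 2]. *)
pose K := 32 * (2 * n%:R + 3) / eps ^+ 2 : R.
have K0 : 0 <= K by rewrite divr_ge0 ?sqr_ge0 // mulr_ge0 // addr_ge0 // mulr_ge0.
(* The successor makes [m] positive and at least [K]. *)
pose m := (Num.trunc K).+1.
have mK : K <= m%:R by rewrite ltW // truncnS_gt.
have Km : m%:R <= K + 1 by rewrite /m -natr1 lerD2r; have /andP[] := truncn_itv K0.
have n2 : 2 <= n%:R :> R by rewrite ler_nat.
exists (main_sampler n m eps) => f f1; split.
  apply: (@le_trans _ _ (8 * m)%:R); first by rewrite ler_nat nqueries_main.
  (* Here [2 n + 3 <= 4 n] as [n >= 2]. With 8 queries per tuple the constant is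
     [8 * 32 * 4 * 16 = 2^14]. *)
  have : K <= 32 * (4 * n%:R) * (16 * (xi^-1 ^+ 2 + 1)).
    by rewrite ler_pM ?invr_ge0 ?sqr_ge0 // ?mulr_ge0 //; lra.
  rewrite natrM; move: (_^-1 ^+ 2) (sqr_ge0 xi^-1) => u u0; nra.
move=> z; apply: le_trans (main_sampler_close _ f1 _ e0 e1 exi xin) _ => //.
rewrite mulrC ler_wpM2r ?invr_ge0 ?exprn_ge0 //.
set v := expR _.
(* Then [2 * 2^n * v <= 2^(-n) / 4 <= xi / 8], which fits in the remaining [xi / 2]. *)
have : v <= (2 ^+ (2 * n + 3))^-1.
  apply: expRN_nat_le; rewrite ler_pdivlMr // -ler_pdivrMr ?exprn_gt0 //.
  by apply: le_trans mK; rewrite /K natrD natrM [_ * 32]mulrC.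
move/(ler_wpM2l (ltW (exprn2_gt0 R n))).
rewrite exprD mul2n -addnn exprD !invfM !mulrA mulfV ?lt0r_neq0 ?exprn2_gt0 // mul1r.
by rewrite -[2 * 2 ^+ n * v]mulrA; move: (2 ^+ n * v) => u; lra.
Qed.

Lemma sampler_exact (R : realType) (n : nat) :
  exists t : sampler R (F2 n) R[i] (F2 n * F2 n)%type,
  forall f : F2 n -> R[i],
    nqueries t f = (2 ^ n)%N /\
    forall z, prob_out t f z = complete (PPtilde f) 0 z.
Proof.
exists (query_all 0 (enum {: F2 n}) (fun g =>
  draw_from (complete (PPtilde g) 0) (@Output _ _ _ _))) => f.
have [g [gf -> q]] := query_allP 0 (enum {: F2 n}) (fun g =>
  draw_from (complete (PPtilde g) 0) (@Output R (F2 n) R[i] (F2 n * F2 n)%type)) f.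
have gE : g = f by apply/boolp.funext => x; rewrite gf // mem_enum.
split=> [|z]; last by rewrite q gE prob_out_draw_output.
rewrite -cardE card_F2 -[RHS]addn0; congr (_ + _)%N; apply/eqP.
by rewrite -leqn0; apply: nqueries_draw_le.
Qed.

Theorem theorem3p13 (R : realType) :
  exists p : {poly R},
  forall (n : nat) (xi : R), (0 < n)%N -> 0 < xi ->
  exists t : sampler R (F2 n) R[i] (F2 n * F2 n)%type,
  forall f : F2 n -> R[i], (forall x, `|f x| <= 1) ->
    (nqueries t f)%:R <= n%:R * ln n%:R * p.[xi^-1] /\
    (mass_condition f xi ->
     exists mu : fdist R (F2 n * F2 n)%type,
       samples_with_prob t f (1 - (n%:R ^+ 2)^-1) mu /\
       forall F : {set F2 n * F2 n},
         `|meas mu F - meas (PPtilde f) F| <= xi * #|F|%:R / 2 ^+ n).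
Proof.
(* Doubling [2^14] compensates for [ln n >= 1/2]; the term ['X] pays for the [2^n <= 2 / xi] queries
   of the exact sampler. *)
exists ((2 ^+ 15)%:P * ('X^2 + 'X + 2%:P)) => n xi n0 xi0.
have -> : ((2 ^+ 15)%:P * ('X^2 + 'X + 2%:P)).[xi^-1] =
    2 ^+ 15 * (xi^-1 ^+ 2 + xi^-1 + 2) :> R.
  by rewrite hornerCM !hornerD hornerXn hornerX hornerC.
have from_points k (t : sampler R (F2 k) R[i] (F2 k * F2 k)%type) f q
    (mu : fdist R (F2 k * F2 k)%type) :
    samples_with_prob t f q mu ->
    (forall z, `|mu z - PPtilde f z| <= xi / 2 ^+ k) ->
    exists mu : fdist R (F2 k * F2 k)%type,
       samples_with_prob t f q mu /\
       forall F : {set F2 k * F2 k},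
         `|meas mu F - meas (PPtilde f) F| <= xi * #|F|%:R / 2 ^+ k.
  by move=> smu close; exists mu; split=> // F; rewrite mulrAC meas_dist_le.
have q1 : 1 - (n%:R ^+ 2)^-1 <= 1 :> R by rewrite gerBl invr_ge0 sqr_ge0.
have [n1|n_le1] := ltnP 1 n; last first.
  have -> : n = 1%N by apply/eqP; rewrite eqn_leq n_le1.
  (* [ln 1 = 0] leaves no queries, but probability [1 - 1 / 1 = 0] is enough. *)
  exists (Output _ _ _ (0, 0)) => f f1; rewrite ln1 mulr0 mul0r; split=> // mc.
  apply: (from_points _ _ _ _ (complete (PPtilde f) 0)).
    by rewrite expr1n invr1 subrr; apply: samples_null.
  by move=> z; apply: complete_PPtilde_close.
have xV0 : 0 < xi^-1 by rewrite invr_gt0.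
have lnn : 1 <= n%:R * ln n%:R :> R.
  have := ln_nat_ge_half R n1; have : 2 <= n%:R :> R by rewrite ler_nat.
  by nra.
(* In the first case the uniform completion fits into half of the error; in the second
   [2^n < 2 / xi], so reading all of [f] is affordable. *)
have [xin|xin] := leP (2 ^+ n)^-1 (xi / 2).
  have [t tP] := sampler_accurate n1 xi0 xin; exists t => f f1.
  have [tq tz] := tP f f1; split=> [|_].
    apply: (le_trans tq); rewrite -mulrA ler_wpM2l //.
    have := ln_nat_ge_half R n1; have x2 := sqr_ge0 xi^-1.
    by move: (ln _) (xi^-1 ^+ 2) x2 => l u; nra.
  by apply: (from_points _ _ _ _ (out_law t f)); [exact: samples_out_law|].
have [t tP] := sampler_exact R n; exists t => f f1.
have [-> tz] := tP f; split=> [|mc].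
  have n2x : 2 ^+ n <= 2 * xi^-1.
    rewrite -[2 ^+ n]invrK -[2 in leRHS]invrK -invfM.
    rewrite lef_pV2 ?posrE ?invr_gt0 ?exprn_gt0 //.
      by rewrite mulrC ltW.
    by rewrite mulr_gt0 ?invr_gt0.
  rewrite natrX; have := sqr_ge0 xi^-1.
  by move: (_ * ln _) (xi^-1 ^+ 2) lnn => l u; nra.
apply: (from_points _ _ _ _ (out_law t f)); first exact: samples_out_law.
by move=> z; rewrite /= tz complete_PPtilde_close.
Qed.
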